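(* Let $(X,f)$ be a dynamical system and let $\alpha\in[0,1)$. Then the following three statements are equivalent: (1) $f$ has the $\mathscr{M}^{\alpha}$-shadowing property; (2) $f^k$ has the $\mathscr{M}^{\alpha}$-shadowing property for every $k\in\mathbb{N}$; (3) $f^k$ has the $\mathscr{M}^{\alpha}$-shadowing property for some $k\in\mathbb{N}$. Likewise, the three statements obtained by replacing $\mathscr{M}^{\alpha}$ with $\mathscr{M}_{\alpha}$ throughout are equivalent.
   Context: $\mathbb{N}=\{1,2,\dots\}$ and $\mathbb{N}_0=\mathbb{N}\cup\{0\}$. A dynamical system $(X,f)$ is a compact metric space $(X,d)$ together with a continuous map $f\colon X\to X$. For $A\subset\mathbb{N}_0$, $\overline{d}(A)=\limsup_{n\to\infty}\frac1n|A\cap\{0,\dots,n-1\}|$ and $\underline{d}(A)=\liminf_{n\to\infty}\frac1n|A\cap\{0,\dots,n-1\}|$. A sequence $\{x_i\}_{i=0}^\infty\subset X$ is a $\delta$-ergodic pseudo-orbit of $f$ if $\lim_{n\to\infty}\frac1n|\{0\le i<n: d(f(x_i),x_{i+1})\ge\delta\}|=0$. The system $(X,f)$ (or $f$) has the $\mathscr{M}^{\alpha}$-shadowing property (resp. the $\mathscr{M}_{\alpha}$-shadowing property) if for every $\varepsilon>0$ there is $\delta>0$ such that for every $\delta$-ergodic pseudo-orbit $\{x_i\}_{i=0}^\infty$ of $f$ there is $z\in X$ with $\overline{d}(\{i\in\mathbb{N}_0: d(f^i(z),x_i)<\varepsilon\})>\alpha$ (resp. $\underline{d}(\{i\in\mathbb{N}_0: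 d(f^i(z),x_i)<\varepsilon\})>\alpha$). *)

(* Defs.v *)
From HB Require Import structures.
From mathcomp Require Import all_boot all_order all_algebra.
From mathcomp Require Import boolp classical_sets reals topology sequences.

Set Implicit Arguments.
Unset Strict Implicit.
Unset Printing Implicit Defensive.

Import Order.TTheory GRing.Theory Num.Theory.
Import numFieldTopology.Exports.

Local Open Scope classical_set_scope.
Local Open Scope ring_scope.

(* The value at n = 0 is 0 / 0 = 0; it plays no role in the limits below. *)
Definition frequency (R : realType) (A : set nat) (n : nat) : R :=
  #|[pred i : 'I_n | nat_of_ord i \in A]|%:R / n%:R.

(* Frequencies lie in [0, 1], so the real-valued limn_sup and limn_inf are the
   usual limits superior and inferior. *)
Definition upper_density (R : realType) (A : set nat) : R :=
  limn_sup (frequency R A).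

Definition lower_density (R : realType) (A : set nat) : R :=
  limn_inf (frequency R A).

Definition ergodic_pseudo_orbit (R : realType) (X : metricType R) (f : X -> X)
    (delta : R) (x : nat -> X) : Prop :=
  frequency R [set i | delta <= mdist (f (x i)) (x i.+1)] @ \oo --> (0 : R).

Definition shadowing_set (R : realType) (X : metricType R) (f : X -> X)
    (eps : R) (z : X) (x : nat -> X) : set nat :=
  [set i | mdist (iter i f z) (x i) < eps].

(* The M^alpha-shadowing property. *)
Definition upper_shadowing (R : realType) (X : metricType R) (alpha : R)
    (f : X -> X) : Prop :=
  forall eps : R, 0 < eps -> exists2 delta : R, 0 < delta &
    forall x : nat -> X, ergodic_pseudo_orbit f delta x ->
      exists z : X, alpha < upper_density R (shadowing_set f eps z x).

(* The M_alpha-shadowing property. *)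
Definition lower_shadowing (R : realType) (X : metricType R) (alpha : R)
    (f : X -> X) : Prop :=
  forall eps : R, 0 < eps -> exists2 delta : R, 0 < delta &
    forall x : nat -> X, ergodic_pseudo_orbit f delta x ->
      exists z : X, alpha < lower_density R (shadowing_set f eps z x).

(* Main.v *)
Require Import Defs.
From mathcomp Require Import all_boot all_order all_algebra.
From mathcomp Require Import boolp classical_sets reals topology sequences.
From mathcomp Require Import normedtype ring lra zify.

Import Order.TTheory GRing.Theory Num.Theory.
Import numFieldTopology.Exports.

Local Open Scope classical_set_scope.
Local Open Scope ring_scope.

(** Time is cut into blocks of length [k]: time [i * k + j] with [j < k] for [f]
belongs to the block that is time [i] for [iter k f]. Both implications pass
between pseudo-orbits of [f] and of [iter k f] along these blocks.

From [f] to [iter k f]: a pseudo-orbit [y] of [iter k f] is filled in by true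
orbit segments, [x (i * k + j) = iter j f (y i)]. Its only jumps are those of
[y], at the ends of blocks. If some point of block [i] is traced closely by [z],
then by uniform continuity the end of the block is traced too, so [z] is close
to [y i.+1] unless [y] jumps at [i]. One traced time per block suffices, and a
block contains at most [k] of them; hence the traced times of [iter k f] are at
least as dense as those of [f] (lemma [density_shadowing_iter]).

From [iter k f] to [f]: a pseudo-orbit [x] of [f] is sampled,
[y i = x (i * k)]. In a block free of jumps, [x] follows the true orbit of
[x (i * k)], so one traced sample makes the whole block traced. The blocks with
a jump have density zero, so again no density is lost
(lemma [density_shadowing_of_iter]).

Neither argument refers to how a density is defined beyond one property: it is
monotone with respect to frequencies that are compared only at multiples of
fixed positive integers and only up to a vanishing error
([asymptotically_monotone]). The upper and lower densities both have it, because
the frequency of a set at [n] and at the last multiple of [k] up to [n] differ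
by at most [k / n] (lemma [frequency_trunc_dist]). The two halves of the theorem
are thus two instances of one statement. Compactness enters only through the
uniform continuity of [f]. *)

(** * Counting and frequencies along blocks *)

Definition hits (A : set nat) (n : nat) : nat := \sum_(0 <= i < n) (i \in A).

Lemma leq_hits (A : set nat) (m n : nat) : (m <= n)%N ->
  (hits A m <= hits A n <= hits A m + (n - m))%N.
Proof.
move=> le_mn; rewrite /hits (big_cat_nat (leq0n m) le_mn) /= leq_addr leq_add2l /=.
by rewrite -[leqRHS]muln1 -sum_nat_const_nat leq_sum // => i _; case: (_ \in _).
Qed.

Lemma hits_blocks (A : set nat) (m k : nat) :
  hits A (m * k) =
    (\sum_(0 <= i < m) \sum_(0 <= j < k) ((i * k + j)%N \in A))%N.
Proof.
rewrite /hits big_nat_mul; apply: eq_bigr => i _.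
rewrite -{1}[(i * k)%N]add0n big_addn mulSn addnK.
by apply: eq_bigr => j _; rewrite addnC.
Qed.

Lemma mem_imply (T : Type) (A B : set T) (x y : T) :
  (A x -> B y) -> ((x \in A) <= (y \in B))%N.
Proof. by move=> AB; case: (boolP (x \in A)) => // /set_mem/AB/mem_set->. Qed.

Section Frequency.
Variable R : realType.
Local Notation frequency := (frequency R).

Lemma frequencyE (A : set nat) (n : nat) :
  frequency A n = (hits A n)%:R / n%:R.
Proof. by rewrite /Defs.frequency -sum1_card big_mkcond /hits big_mkord. Qed.

Lemma frequency_ge0 A n : 0 <= frequency A n.
Proof. by rewrite divr_ge0. Qed.

Lemma frequency_le1 A n : frequency A n <= 1.
Proof.
rewrite /Defs.frequency; case: n => [|n]; first by rewrite invr0 mulr0.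
by rewrite ler_pdivrMr ?ltr0n// mul1r ler_nat -[leqRHS]card_ord max_card.
Qed.

Lemma bounded_frequency A : bounded_fun (frequency A : nat -> R^o).
Proof.
exists 1; split => // M ltM n _ /=.
by rewrite ger0_norm ?frequency_ge0// (le_trans (frequency_le1 A n))// ltW.
Qed.

Lemma frequency_le_setU (A B C : set nat) n :
  (forall i, A i -> B i \/ C i) ->
  frequency A n <= frequency B n + frequency C n.
Proof.
move=> ABC; rewrite !frequencyE -mulrDl ler_wpM2r ?invr_ge0//.
rewrite -natrD ler_nat /hits -big_split leq_sum //= => i _.
case: (boolP (i \in A)) => // /set_mem/ABC[] /mem_set ->; lia.
Qed.

(** Shifting a set by one can bring in at most one new element below [n]. *)
Lemma frequency_shift (A : set nat) n :
  frequency [set i | A i.+1] n <= frequency A n + n%:R^-1.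
Proof.
rewrite !frequencyE -[X in _ + X]mul1r -mulrDl ler_wpM2r ?invr_ge0//.
rewrite natr1 ler_nat.
have /andP[_] := leq_hits A _ _ (leqnSn n); rewrite subSnn addn1.
apply: leq_trans; rewrite /hits [leqRHS]big_nat_recl //=.
apply: leq_trans (leq_addl _ _); apply: leq_sum => i _; exact: mem_imply.
Qed.

(** A block meets [A] in at most [k] times, and [k] is exactly the factor between
the two denominators. *)
Lemma block_frequency_le (A C : set nat) (k m : nat) : (0 < k)%N ->
  (forall i j, (j < k)%N -> A (i * k + j)%N -> C i) ->
  frequency A (m * k) <= frequency C m.
Proof.
move=> k0 AC; rewrite !frequencyE natrM invfM mulrA mulrAC ler_wpM2r ?invr_ge0//.
rewrite ler_pdivrMr ?ltr0n// -natrM ler_nat hits_blocks /hits big_distrl leq_sum//=.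
move=> i _; rewrite [leqRHS]mulnC -[X in (_ <= X * _)%N]subn0 -sum_nat_const_nat.
by rewrite !big_mkord leq_sum// => j _; apply: mem_imply; apply: AC.
Qed.

Lemma block_frequency_ge (A C : set nat) (k m : nat) : (0 < k)%N ->
  (forall i j, (j < k)%N -> C i -> A (i * k + j)%N) ->
  frequency C m <= frequency A (m * k).
Proof.
move=> k0 CA; rewrite !frequencyE natrM invfM mulrA mulrAC ler_wpM2r ?invr_ge0//.
rewrite ler_pdivlMr ?ltr0n// -natrM ler_nat hits_blocks /hits big_distrl leq_sum//=.
move=> i _; rewrite [leqLHS]mulnC -[X in (X * _ <= _)%N]subn0 -sum_nat_const_nat.
by rewrite !big_mkord leq_sum// => j _; apply: mem_imply; apply: CA.
Qed.

(** With a single element of [A] granted per block, the change of denominator is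
no longer compensated and costs the factor [k]; this is harmless for sets of
density zero. *)
Lemma block_frequency_hit (A C : set nat) (k m : nat) : (0 < k)%N ->
  (forall i, C i -> exists2 j, (j < k)%N & A (i * k + j)%N) ->
  frequency C m <= k%:R * frequency A (m * k).
Proof.
move=> k0 CA; rewrite !frequencyE natrM invfM.
have -> (a b : R) : k%:R * (a * (b / k%:R)) = a * b.
  by field; rewrite pnatr_eq0 -lt0n.
rewrite ler_wpM2r ?invr_ge0// ler_nat hits_blocks /hits leq_sum// => i _.
case: (boolP (i \in C)) => // /set_mem/CA[j ltjk Aij].
by rewrite big_mkord (bigD1 (Ordinal ltjk)) //= mem_set.
Qed.

(** Passing from [q = n %/ k * k] to [n] adds at most [n - q < k] hits, while
enlarging the denominator removes [t * (n - q)] from the numerator, where [t] is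
the frequency at [q]. Both corrections lie between [0] and [n - q], and they have
opposite signs. *)
Lemma frequency_trunc_dist (A : set nat) (k n : nat) : (0 < k)%N ->
  `|frequency A n - frequency A (n %/ k * k)| <= k%:R / n%:R.
Proof.
move=> k0; case: (posnP n) => [->|n0].
  by rewrite div0n mul0n subrr normr0 mulr_ge0 ?invr_ge0.
have [le1 le2] : (n %/ k * k <= n /\ n - n %/ k * k <= k)%N.
  split; first exact: leq_trunc_div.
  by rewrite leq_subLR {1}(divn_eq n k) leq_add2l ltnW// ltn_mod.
rewrite (frequencyE A n).
(* The equation below also holds at a zero denominator, where both sides are 0. *)
set t := frequency A _.
have tE : t * (n %/ k * k)%:R = (hits A (n %/ k * k))%:R.
  rewrite /t frequencyE; case: (posnP (n %/ k * k)) => [->|q0].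
    by rewrite /hits big_geq// !mul0r.
  by rewrite divfK// pnatr_eq0 -lt0n.
have n0R : 0 < n%:R :> R by rewrite ltr0n.
have -> : (hits A n)%:R / n%:R - t =
    ((hits A n)%:R - (hits A (n %/ k * k))%:R - t * (n - n %/ k * k)%:R) / n%:R.
  rewrite natrB// mulrBr tE; field; lra.
rewrite normrM normfV (gtr0_norm n0R) ler_wpM2r ?invr_ge0//.
have /andP[h1 h2] := leq_hits A _ _ le1.
rewrite -natrB//.
have : t * (n - n %/ k * k)%:R <= (n - n %/ k * k)%:R.
  by rewrite ler_piMl ?frequency_le1.
have : 0 <= t * (n - n %/ k * k)%:R by rewrite mulr_ge0 ?frequency_ge0.
have : ((n - n %/ k * k)%:R : R) <= k%:R by rewrite ler_nat.
have : ((hits A n - hits A (n %/ k * k))%:R : R) <= (n - n %/ k * k)%:R.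
  by rewrite ler_nat leq_subLR.
have : 0 <= ((hits A n - hits A (n %/ k * k))%:R : R) by [].
rewrite ler_norml; move: (t * _) => s; lra.
Qed.

End Frequency.

(** * Comparing limits superior and inferior *)

Section LimitSuperior.
Variable R : realType.
Implicit Types (u v : nat -> R^o) (e : nat -> R).

Lemma limn_sup_le_near u (c : R) : bounded_fun u ->
  (\forall n \near \oo, u n <= c) -> limn_sup u <= c.
Proof.
move=> bu [N _ uc]; rewrite limn_supE//.
apply: le_trans (_ : sups u N <= c).
  by apply: ge_inf; [exact: bounded_fun_has_lbound_sups | exists N].
by apply: ge_sup => [|_ [n Nn <-]]; [exists (u N), N => /= | exact: uc].
Qed.

Lemma near_le_limn_sup u (c : R) : bounded_fun u ->
  limn_sup u < c -> \forall n \near \oo, u n <= c.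
Proof.
move=> bu; rewrite limn_supE// => /inf_lt[|_ [N _ <-] lt_c].
  by exists (sups u 0), 0%N.
exists N => // n Nn; apply/ltW/(le_lt_trans _ lt_c).
apply: ub_le_sup; last by exists n.
exact/has_ubound_sdrop/bounded_fun_has_ubound.
Qed.

Lemma limn_inf_ge_near u (c : R) : bounded_fun u ->
  (\forall n \near \oo, c <= u n) -> c <= limn_inf u.
Proof.
move=> bu [N _ uc]; rewrite limn_infE//.
apply: le_trans (_ : c <= infs u N) _.
  by apply: lb_le_inf => [|_ [n Nn <-]]; [exists (u N), N => /= | exact: uc].
by apply: ub_le_sup; [exact: bounded_fun_has_ubound_infs | exists N].
Qed.

Lemma near_ge_limn_inf u (c : R) : bounded_fun u ->
  c < limn_inf u -> \forall n \near \oo, c <= u n.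
Proof.
move=> bu; rewrite limn_infE// => /sup_gt[|_ [N _ <-] lt_c].
  by exists (infs u 0), 0%N.
exists N => // n Nn; apply/ltW/(lt_le_trans lt_c).
apply: ge_inf; last by exists n.
exact/has_lbound_sdrop/bounded_fun_has_lbound.
Qed.

(** Each term of [u] is bounded by a far term of [v], and a limit superior sees an
upper bound on the tail of [v]. *)
Lemma le_limn_sup_comp u v e (phi : nat -> nat) :
  bounded_fun u -> bounded_fun v ->
  phi @ \oo --> \oo -> e @ \oo --> (0 : R) ->
  (forall n, u n <= v (phi n) + e n) -> limn_sup u <= limn_sup v.
Proof.
move=> bu bv phioo e0 uv; apply/ler_addgt0Pr => d d0.
apply: limn_sup_le_near => //.
have hv : \forall n \near \oo, v (phi n) <= limn_sup v + d / 2.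
  by apply: (phioo [set m | v m <= _]); apply: near_le_limn_sup => //; lra.
have he : \forall n \near \oo, `|e n| <= d / 2.
  by apply: (cvgr0_norm_le (V := R^o)) => //; lra.
near=> n; have := uv n.
have : v (phi n) <= limn_sup v + d / 2 by near: n.
have : e n <= d / 2 by apply: le_trans (ler_norm _) _; near: n.
lra.
Unshelve. all: by end_near. Qed.

(** Dually, a limit inferior sees a lower bound on the tail of [u], so here it is
[u] that is evaluated along [phi]. *)
Lemma le_limn_inf_comp u v e (phi : nat -> nat) :
  bounded_fun u -> bounded_fun v ->
  phi @ \oo --> \oo -> e @ \oo --> (0 : R) ->
  (forall n, u (phi n) <= v n + e n) -> limn_inf u <= limn_inf v.
Proof.
move=> bu bv phioo e0 uv; apply/ler_addgt0Pr => d d0.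
rewrite -lerBlDr; apply: limn_inf_ge_near => //.
have hu : \forall n \near \oo, limn_inf u - d / 2 <= u (phi n).
  by apply: (phioo [set m | _ <= u m]); apply: near_ge_limn_inf => //; lra.
have he : \forall n \near \oo, `|e n| <= d / 2.
  by apply: (cvgr0_norm_le (V := R^o)) => //; lra.
near=> n; have := uv n.
have : limn_inf u - d / 2 <= u (phi n) by near: n.
have : e n <= d / 2 by apply: le_trans (ler_norm _) _; near: n.
lra.
Unshelve. all: by end_near. Qed.

End LimitSuperior.

Lemma cvg_divn (k : nat) : (0 < k)%N -> (n %/ k)%N @[n --> \oo] --> \oo.
Proof.
move=> k0; apply/cvgnyPge => N; exists (N * k)%N => // n /=.
by rewrite leq_divRL.
Qed.

(** * Densities that depend only on frequencies along multiples *)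

Section AsymptoticallyMonotone.
Variable R : realType.

(** The sampling steps [k] and [l] differ for the two sets so that a set of times
for [f] can be compared with a set of times for an iterate of [f]. *)
Definition asymptotically_monotone (D : set nat -> R) : Prop :=
  forall (k l : nat) (A B : set nat) (e : nat -> R),
    (0 < k)%N -> (0 < l)%N -> e @ \oo --> (0 : R) ->
    (forall m, frequency R A (m * k) <= frequency R B (m * l) + e m) ->
    D A <= D B.

Lemma cvg_natrV : n%:R^-1 @[n --> \oo] --> (0 : R).
Proof.
by apply/gtr0_cvgV0; [exists 1%N => // n /=; rewrite ltr0n | exact: cvgr_idn].
Qed.

Lemma cvg0_le (u v : nat -> R) : (forall n, 0 <= u n <= v n) ->
  v @ \oo --> (0 : R) -> u @ \oo --> (0 : R).
Proof.
move=> uv; apply: (@squeeze_cvgr _ _ _ _ (fun=> 0)) => //; last exact: cvg_cst.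
exact: nearW.
Qed.

Lemma cvg_frequency_trunc (A : set nat) (k : nat) : (0 < k)%N ->
  frequency R A n - frequency R A (n %/ k * k) @[n --> \oo] --> (0 : R).
Proof.
move=> k0; apply: (@norm_cvg0 _ R^o).
apply: (@cvg0_le _ (fun n => k%:R * n%:R^-1)).
  by move=> n; rewrite normr_ge0 frequency_trunc_dist.
by rewrite -[X in _ --> X](mulr0 k%:R); apply: cvgMr; exact: cvg_natrV.
Qed.

Lemma upper_density_asymptotically_monotone :
  asymptotically_monotone (@upper_density R).
Proof.
move=> k l A B e k0 l0 e0 AB.
apply: (@le_limn_sup_comp _ _ _
  (fun n => e (n %/ k)%N + (frequency R A n - frequency R A (n %/ k * k)))
  (fun n => n %/ k * l)%N); do ?exact: bounded_frequency.
- exact: (cvg_comp _ _ (cvg_divn _ k0) (cvg_mulnr _ l0)).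
- rewrite -[X in _ --> X]addr0; apply: (@cvgD _ R^o); last exact: cvg_frequency_trunc.
  exact: (cvg_comp _ _ (cvg_divn _ k0) e0).
- by move=> n; have := AB (n %/ k)%N; lra.
Qed.

Lemma lower_density_asymptotically_monotone :
  asymptotically_monotone (@lower_density R).
Proof.
move=> k l A B e k0 l0 e0 AB.
apply: (@le_limn_inf_comp _ _ _
  (fun n => e (n %/ l)%N - (frequency R B n - frequency R B (n %/ l * l)))
  (fun n => n %/ l * k)%N); do ?exact: bounded_frequency.
- exact: (cvg_comp _ _ (cvg_divn _ l0) (cvg_mulnr _ k0)).
- rewrite -[X in _ --> X]subr0; apply: (@cvgB _ R^o); last exact: cvg_frequency_trunc.
  exact: (cvg_comp _ _ (cvg_divn _ l0) e0).
- by move=> n; have := AB (n %/ l)%N; lra.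
Qed.

Lemma cvg_frequency_blocks (A : set nat) (k : nat) : (0 < k)%N ->
  frequency R A (m * k) @[m --> \oo] --> (0 : R) ->
  frequency R A @ \oo --> (0 : R).
Proof.
move=> k0 cA.
have -> : frequency R A = fun n => frequency R A (n %/ k * k) +
    (frequency R A n - frequency R A (n %/ k * k)).
  by apply/funext => n; ring.
rewrite -[X in _ --> X]addr0; apply: (@cvgD _ R^o); last exact: cvg_frequency_trunc.
exact: (cvg_comp _ _ (cvg_divn _ k0) cA).
Qed.

End AsymptoticallyMonotone.

(** * Shadowing for a map and its iterates *)

Section Dynamics.
Variables (R : realType) (X : metricType R).
Implicit Types f : X -> X.

(** Continuity gives a modulus valid near each point; compactness, in the form of
near coverings, makes one modulus work everywhere. *)
Lemma compact_uniform_modulus f (e : R) :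
  compact [set: X] -> continuous f -> 0 < e ->
  exists2 d : R, 0 < d & forall a b, mdist a b < d -> mdist (f a) (f b) < e.
Proof.
move=> /compact_near_coveringP cX cf e0.
have : \forall d \near (0 : R)^'+,
    [set: X] `<=` (fun a => forall b, mdist a b < d -> mdist (f a) (f b) < e).
  apply: (cX _ _ (fun d a => forall b, mdist a b < d -> mdist (f a) (f b) < e)).
  move=> a _.
  have e2 : 0 < e / 2 by lra.
  have /metricType_numDomainType.nbhs_mdistP[r /= r0 rP] :
      \forall b \near a, mdist (f a) (f b) < e / 2.
    exact/(metricType_numDomainType.cvgr_dist_lt (cf a)).
  have r2 : 0 < r / 2 by lra.
  exists ([set b | mdist a b < r / 2], [set d | d < r / 2]).
    split; last exact: nbhs_right_lt.
    by apply/metricType_numDomainType.nbhs_mdistP; exists (r / 2).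
  move=> [a' d] [/= aa' dr] b a'b.
  have fa : mdist (f a) (f a') < e / 2 by apply: rP => /=; lra.
  have fb : mdist (f a) (f b) < e / 2.
    by apply: rP => /=; have := metric_triangle a a' b; lra.
  by have := metric_triangle (f a') (f a) (f b); rewrite (metric_sym (f a') (f a)); lra.
move=> H; near (0 : R)^'+ => d.
exists d; first by near: d; exact: nbhs_right_gt.
by move=> a; move: a I; near: d.
Unshelve. all: by end_near. Qed.

Section UniformlyContinuous.
Variable f : X -> X.
Hypothesis unif_f : forall e : R, 0 < e ->
  exists2 d : R, 0 < d & forall a b, mdist a b < d -> mdist (f a) (f b) < e.

Lemma iter_modulus (k : nat) (e : R) : 0 < e ->
  exists2 d : R, 0 < d & forall j a b, (j <= k)%N -> mdist a b < d ->
    mdist (iter j f a) (iter j f b) < e.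
Proof.
move=> e0; elim: k => [|k [d d0 IH]].
  by exists e => // j a b; rewrite leqn0 => /eqP->.
have [d' d'0 fd'] := unif_f _ d0.
exists (Num.min e d'); first by rewrite lt_min e0.
move=> [|j] a b jk; rewrite lt_min => /andP[abe abd'] //.
by rewrite !iterSr; apply: IH => //; exact: fd'.
Qed.

(** The error of following the true orbit for [k] steps is controlled inductively:
one more step adds one jump to the image under [f] of the previous error. *)
Lemma iter_tracking (k : nat) (e : R) : 0 < e ->
  exists2 d : R, 0 < d & forall (x : nat -> X) n,
    (forall j, (j < k)%N -> mdist (f (x (n + j)%N)) (x (n + j).+1) < d) ->
    forall j, (j <= k)%N -> mdist (iter j f (x n)) (x (n + j)%N) < e.
Proof.
elim: k e => [|k IH] e e0.
  by exists e => // x n _ j; rewrite leqn0 => /eqP->; rewrite addn0 mdistxx.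
have e2 : 0 < e / 2 by lra.
have [c c0 fc] := unif_f _ e2.
have [|d d0 dP] := IH (Num.min c e); first by rewrite lt_min c0.
exists (Num.min d (e / 2)); first by rewrite lt_min d0.
move=> x n small j.
have {}dP i : (i <= k)%N -> mdist (iter i f (x n)) (x (n + i)%N) < Num.min c e.
  apply: dP => {}i ik; have := small i (leqW ik).
  by rewrite lt_min => /andP[].
rewrite leq_eqVlt => /predU1P[->|/dP]; last by rewrite lt_min => /andP[].
have := dP k (leqnn k); rewrite lt_min => /andP[/fc fk _].
have := small k (ltnSn k); rewrite lt_min => /andP[_ sk].
rewrite addnS iterS.
by have := metric_triangle (f (iter k f (x n))) (f (x (n + k)%N))
  (x (n + k).+1); lra.
Qed.

Variables (D : set nat -> R) (alpha : R).
Hypothesis monotone_D : asymptotically_monotone R D.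

(** For [D] the upper or the lower density this unfolds to [upper_shadowing] or
[lower_shadowing]. *)
Definition density_shadowing (g : X -> X) : Prop :=
  forall eps : R, 0 < eps -> exists2 delta : R, 0 < delta &
    forall x : nat -> X, ergodic_pseudo_orbit g delta x ->
      exists z : X, alpha < D (shadowing_set g eps z x).

(** Filling in a pseudo-orbit of [iter k f] by orbit segments of [f]: a block with
a time traced by [z] carries the proximity to its end, that is, to the next
sample. *)
Lemma density_shadowing_iter (k : nat) : (0 < k)%N ->
  density_shadowing f -> density_shadowing (iter k f).
Proof.
move=> k0 shf eps eps0.
have eps2 : 0 < eps / 2 by lra.
have [rho rho0 rhoP] := iter_modulus k _ eps2.
have [delta delta0 deltaP] := shf rho rho0.
exists (Num.min delta (eps / 2)); first by rewrite lt_min delta0.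
move=> y cE.
pose E := [set i | Num.min delta (eps / 2) <= mdist (iter k f (y i)) (y i.+1)].
pose x n := iter (n %% k) f (y (n %/ k)%N).
have xE i j : (j < k)%N -> x (i * k + j)%N = iter j f (y i).
  by move=> jk; rewrite /x modnMDl modn_small// divnMDl// divn_small// addn0.
(* Within a block [x] is a true orbit, so it can only jump where [y] does. *)
have [|z lt_alpha] := deltaP x.
  apply: (cvg_frequency_blocks _ _ k k0).
  apply: (cvg0_le _ _ _ _ cE) => m; rewrite frequency_ge0/=.
  apply: block_frequency_le => // i j jk; rewrite /E /= xE//.
  move: jk; rewrite leq_eqVlt => /predU1P[jk|jk].
    have -> : ((i * k + j).+1 = i.+1 * k + 0)%N by rewrite addn0 mulSn; lia.
    by rewrite xE// -iterS jk ge_min => ->.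
  by rewrite -addnS xE// mdistxx leNgt delta0.
exists z; apply: lt_le_trans lt_alpha _.
set A := shadowing_set _ _ _ _; set B := shadowing_set _ _ _ _.
have AB i j : (j < k)%N -> A (i * k + j)%N -> B i.+1 \/ E i.
  move=> jk; rewrite /A /shadowing_set /= xE// => close_ij.
  have [Ei|] := pselect (E i); [by right | move=> nEi; left].
  rewrite /B /shadowing_set /mkset -iterM.
  have : mdist (iter k f (y i)) (y i.+1) < eps / 2.
    by move/negP: nEi; rewrite -ltNge lt_min => /andP[].
  have := rhoP (k - j)%N _ _ (leq_subr j k) close_ij.
  rewrite -!iterD subnK ?(ltnW jk)//.
    have -> : (k - j + (i * k + j) = i.+1 * k)%N by rewrite mulSn; lia.
  by have := metric_triangle (iter (i.+1 * k) f z) (iter k f (y i)) (y i.+1); lra.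
(* The term [m%:R^-1] pays for replacing [i.+1] by [i]. *)
apply: (monotone_D k 1%N _ _
    (fun m => m%:R^-1 + frequency R E m)) => //.
  by rewrite -[X in _ --> X]addr0; apply: (@cvgD _ R^o); [exact: cvg_natrV|].
move=> m; rewrite muln1 addrA.
apply: le_trans (_ : _ <= frequency R [set i | B i.+1] m + frequency R E m) _.
  apply: le_trans (block_frequency_le _ _ [set i | B i.+1 \/ E i] k m k0 AB) _.
  exact: frequency_le_setU.
by rewrite lerD2r frequency_shift.
Qed.

(** Sampling a pseudo-orbit of [f]: a traced sample whose block has no jump makes
all [k] times of that block traced. *)
Lemma density_shadowing_of_iter (k : nat) : (0 < k)%N ->
  density_shadowing (iter k f) -> density_shadowing f.
Proof.
move=> k0 shfk eps eps0.
have eps2 : 0 < eps / 2 by lra.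
have [rho rho0 rhoP] := iter_modulus k _ eps2.
have [delta' delta'0 delta'P] := shfk rho rho0.
have [|delta delta0 deltaP] := iter_tracking k (Num.min delta' (eps / 2)).
  by rewrite lt_min delta'0.
exists delta => // x cbad.
pose bad := [set n | delta <= mdist (f (x n)) (x n.+1)].
(* The blocks that contain a jump of [x]. *)
pose E := [set i | exists2 j, (j < k)%N & bad (i * k + j)%N].
have nEP i : ~ E i -> forall j, (j <= k)%N ->
    mdist (iter j f (x (i * k)%N)) (x (i * k + j)%N) < Num.min delta' (eps / 2).
  move=> nEi; apply: deltaP => j jk; rewrite ltNge; apply/negP => bad_ij.
  by apply: nEi; exists j.
have cE : frequency R E @ \oo --> (0 : R).
  apply: (cvg0_le _ _ (fun m => k%:R * frequency R bad (m * k))).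
    by move=> m; rewrite frequency_ge0 block_frequency_hit.
  rewrite -[X in _ --> X](mulr0 (k%:R : R)); apply: cvgMr.
  exact: (cvg_comp _ _ (cvg_mulnr _ k0) cbad).
(* The samples jump only across blocks in which [x] jumps. *)
have [|z lt_alpha] := delta'P (fun i => x (i * k)%N).
  apply: (cvg0_le _ _ _ _ cE) => m; rewrite frequency_ge0/=.
  rewrite -[m in leLHS]muln1; apply: block_frequency_le => // i j.
  rewrite ltnS leqn0 => /eqP ->; rewrite muln1 addn0 /= leNgt => /negP bad_i.
  apply: contrapT => /nEP /(_ k (leqnn k)); rewrite lt_min => /andP[+ _].
  by rewrite addnC -mulSn.
exists z; apply: lt_le_trans lt_alpha _.
set B := shadowing_set _ _ _ _; set A := shadowing_set _ _ _ _.
have BA i j : (j < k)%N -> (B `\` E) i -> A (i * k + j)%N.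
  move=> /ltnW jk [Bi /nEP/(_ j jk)]; rewrite lt_min => /andP[_ trk].
  move: Bi; rewrite /A /B /shadowing_set /= -iterM => /(rhoP j _ _ jk).
  rewrite -iterD [in (j + _)%N]addnC.
  by have := metric_triangle (iter (i * k + j) f z) (iter j f (x (i * k)%N))
    (x (i * k + j)%N); lra.
(* Outside the sparse set [E], each traced sample gives a full block of traced
   times, which compensates for the longer time scale of [f]. *)
apply: (monotone_D 1%N k _ _ (frequency R E)) => // m; rewrite muln1.
apply: le_trans (_ : _ <= frequency R (B `\` E) m + frequency R E m) _.
  apply: frequency_le_setU => i Bi.
  by have [|] := pselect (E i); [right | left].
by rewrite lerD2r block_frequency_ge.
Qed.

Lemma density_shadowing_iter_tfae :
  [<-> density_shadowing f;
       forall k : nat, (0 < k)%N -> density_shadowing (iter k f);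
       exists2 k : nat, (0 < k)%N & density_shadowing (iter k f)].
Proof.
tfae.
- by move=> shf k k0; exact: density_shadowing_iter.
- by move=> sh; exists 1%N => //; exact: sh.
- by move=> [k k0]; exact: density_shadowing_of_iter.
Qed.

End UniformlyContinuous.
End Dynamics.

Theorem theorem3p6 (R : realType) (X : metricType R) (f : X -> X) (alpha : R)
    (compactX : compact [set: X]) (continuous_f : continuous f)
    (alpha_ge0 : 0 <= alpha) (alpha_lt1 : alpha < 1) :
  [<-> upper_shadowing alpha f;
       forall k : nat, (0 < k)%N -> upper_shadowing alpha (iter k f);
       exists2 k : nat, (0 < k)%N & upper_shadowing alpha (iter k f)] /\
  [<-> lower_shadowing alpha f;
       forall k : nat, (0 < k)%N -> lower_shadowing alpha (iter k f);
       exists2 k : nat, (0 < k)%N & lower_shadowing alpha (iter k f)].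
Proof.
have unif_f e := compact_uniform_modulus _ _ f e compactX continuous_f.
split.
- exact: (density_shadowing_iter_tfae _ _ _ unif_f _ _
    (upper_density_asymptotically_monotone R)).
- exact: (density_shadowing_iter_tfae _ _ _ unif_f _ _
    (lower_density_asymptotically_monotone R)).
Qed.
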